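(* Let $\mathbb{L},t,\lambda_2,\lambda_3,\dots$ be independent variables, put $\lambda_1=\mathbb{L}$, and let $(G_{k,m})_{k,m\ge1}$, $G_{k,m}=G_{k,m}(t,\mathbb{L},\lambda_1,\lambda_2,\dots)$, be the family satisfying $G_{1,1}=(\mathbb{L}-1)^2\mathbb{L}^{-2}$ and, for all $k,m\geq 1$, $$G_{k,m}=G_{m,k};\qquad G_{k,m}=t^{k(k-1)}\mathbb{L}^{-k}\,G_{k,m-k}\ \text{ for } m>k;\qquad G_{k,k}=(\lambda_k-1)\sum_{m>k}G_{k,m}.$$ Then for all $k,m\ge1$ $$G_{k,m}(t^{-1},\mathbb{L}^{-1},\lambda_1^{-1},\lambda_2^{-1},\dots)=t^{-2(k-1)(m-1)}\,\mathbb{L}^{2k+2m-2}\cdot G_{k,m}(t,\mathbb{L},\lambda_1,\lambda_2,\dots).$$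
   Context: The $G_{k,m}$ are elements of the ring $\mathbb{Z}[\lambda_2,\lambda_3,\dots]((\mathbb{L}^{-1}))[[t]]$, with infinite sums converging coefficientwise in $t$ in the $\mathbb{L}^{-1}$-adic topology. The relations determine the family uniquely, and each $G_{k,m}$ is the expansion of a unique rational function in $t,\mathbb{L}$ and finitely many of the $\lambda_i$; the left-hand side of the claimed identity means the substitution $t\mapsto t^{-1}$, $\mathbb{L}\mapsto\mathbb{L}^{-1}$, $\lambda_i\mapsto\lambda_i^{-1}$ (for all $i$) in this rational function. *)

(* Defs.v *)
From HB Require Import structures.
From mathcomp Require Import all_boot all_order all_algebra.
From mathcomp Require Import finmap zify ring.
From mathcomp Require Import boolp classical_sets fsbigop.
From mathcomp.multinomials Require Import monalg.

Set Implicit Arguments.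
Unset Strict Implicit.
Unset Printing Implicit Defensive.

Import Order.TTheory GRing.Theory Num.Theory.
Local Open Scope ring_scope.

Record pseries (R : nzRingType) := PSeries { pcoef : nat -> R }.

HB.instance Definition _ R := gen_eqMixin (pseries R).
HB.instance Definition _ R := gen_choiceMixin (pseries R).

Section PSeries.
Variable R : comNzRingType.
Implicit Types f g h : pseries R.

Lemma pseriesP f g : (forall n, pcoef f n = pcoef g n) -> f = g.
Proof. by case: f g => [f] [g] /= fg; congr PSeries; apply/funext. Qed.

Definition padd f g := PSeries (fun n => pcoef f n + pcoef g n).
Definition popp f := PSeries (fun n => - pcoef f n).
Definition pconst (c : R) := PSeries (fun n => if n == 0%N then c else 0).
Definition pmul f g :=
  PSeries (fun n => \sum_(i < n.+1) pcoef f i * pcoef g (n - i)%N).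
Definition pvar : pseries R := PSeries (fun n => (n == 1%N)%:R).

Fact paddA : associative padd.
Proof. by move=> f g h; apply: pseriesP => n /=; rewrite addrA. Qed.
Fact paddC : commutative padd.
Proof. by move=> f g; apply: pseriesP => n /=; rewrite addrC. Qed.
Fact padd0 : left_id (pconst 0) padd.
Proof. by move=> f; apply: pseriesP => n /=; rewrite if_same add0r. Qed.
Fact paddN : left_inverse (pconst 0) popp padd.
Proof. by move=> f; apply: pseriesP => n /=; rewrite if_same addNr. Qed.

HB.instance Definition _ :=
  GRing.isZmodule.Build (pseries R) paddA paddC padd0 paddN.

Let tr n f : {poly R} := \poly_(i < n.+1) pcoef f i.

Let coef_tr n f i : (i <= n)%N -> (tr n f)`_i = pcoef f i.
Proof. by move=> le_in; rewrite coef_poly ltnS le_in. Qed.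

Let coef_trM n f g i : (i <= n)%N -> (tr n f * tr n g)`_i = pcoef (pmul f g) i.
Proof.
move=> le_in; rewrite coefM /=; apply: eq_bigr => j _.
by rewrite !coef_tr //; have := ltn_ord j; lia.
Qed.

Fact pmulA : associative pmul.
Proof.
move=> f g h; apply: pseriesP => n.
transitivity (tr n f * (tr n g * tr n h))`_n.
  rewrite coefM; apply: eq_bigr => j _.
  by rewrite coef_trM ?coef_tr //; have := ltn_ord j; lia.
rewrite mulrA coefM; apply: eq_bigr => j _.
by rewrite coef_trM ?coef_tr //; have := ltn_ord j; lia.
Qed.
Fact pmulC : commutative pmul.
Proof.
by move=> f g; apply: pseriesP => n; rewrite -!(coef_trM _ _ (leqnn n)) mulrC.
Qed.
Fact pmul1 : left_id (pconst 1) pmul.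
Proof.
move=> f; apply: pseriesP => n /=; rewrite big_ord_recl /= mul1r subn0.
by rewrite big1 ?addr0 // => i _; rewrite mul0r.
Qed.
Fact pmulDl : left_distributive pmul padd.
Proof.
move=> f g h; apply: pseriesP => n /=; rewrite -big_split /=.
by apply: eq_bigr => i _; rewrite mulrDl.
Qed.
Fact pone_neq0 : pconst 1 != 0.
Proof.
apply/eqP => /(congr1 (fun f => pcoef f 0)) /= /eqP.
by rewrite (oner_eq0 R).
Qed.

HB.instance Definition _ :=
  GRing.Zmodule_isComNzRing.Build (pseries R)
    pmulA pmulC pmul1 pmulDl pone_neq0.

Lemma pcoefM f g n :
  pcoef (f * g) n = \sum_(i < n.+1) pcoef f i * pcoef g (n - i)%N.
Proof. by []. Qed.

Fact pconst_is_zmod_morphism : zmod_morphism pconst.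
Proof.
by move=> a b; apply: pseriesP => n /=; case: eqP; rewrite // subr0.
Qed.
Fact pconst_is_monoid_morphism : monoid_morphism pconst.
Proof.
split=> // a b; apply: pseriesP => n /=.
rewrite big_ord_recl /= subn0 big1 ?addr0; last by move=> i _; rewrite mul0r.
by case: eqP; rewrite // mulr0.
Qed.

HB.instance Definition _ :=
  GRing.isZmodMorphism.Build R (pseries R) pconst pconst_is_zmod_morphism.
HB.instance Definition _ :=
  GRing.isMonoidMorphism.Build R (pseries R) pconst pconst_is_monoid_morphism.

End PSeries.

Definition lbounded (R : nzRingType) (f : int -> R) :=
  exists N : nat, forall j : int, j < - N%:Z -> f j = 0.

Record laurent (R : nzRingType) :=
  Laurent { lcoef : int -> R; lcoefP : lbounded lcoef }.

HB.instance Definition _ R := gen_eqMixin (laurent R).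
HB.instance Definition _ R := gen_choiceMixin (laurent R).

Section Laurent.
Variable R : comNzRingType.
Implicit Types f g h : laurent R.

Lemma laurentP f g : (forall j, lcoef f j = lcoef g j) -> f = g.
Proof.
case: f g => [f fP] [g gP] /= fg.
have {}fg : f = g by apply/funext.
by case: _ / fg in gP *; congr Laurent; apply: Prop_irrelevance.
Qed.

Let bnd (N : nat) (f : int -> R) := forall j : int, j < - N%:Z -> f j = 0.

Let bndW N M (f : int -> R) : (N <= M)%N -> bnd N f -> bnd M f.
Proof. by move=> NM fN j jM; apply: fN; lia. Qed.

Let mulc (f g : int -> R) (j : int) := \sum_(i \in [set: int]) f i * g (j - i).

Let sh N (f : int -> R) : pseries R := PSeries (fun i : nat => f (i%:Z - N%:Z)).

Let mulc_lt N M (f g : int -> R) (j : int) :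
  bnd N f -> bnd M g -> j < - (N + M)%N%:Z ->
  mulc f g j = 0.
Proof.
move=> fN gM jlt; apply: fsbig1 => i _.
have [iN|iN] := boolP (i < - N%:Z); first by rewrite fN ?mul0r.
by rewrite [g _]gM ?mulr0 //; lia.
Qed.

Let mulc_sh N M (f g : int -> R) (n : nat) : bnd N f -> bnd M g ->
  mulc f g (n%:Z - (N + M)%N%:Z) = pcoef (sh N f * sh M g) n.
Proof.
move=> fN gM; pose s : seq int := [seq k%:Z - N%:Z | k <- iota 0 n.+1].
have s_uniq : uniq s by rewrite map_inj_uniq ?iota_uniq // => a b; lia.
have supp (i : int) : i \notin s -> f i * g (n%:Z - (N + M)%N%:Z - i) = 0.
  move=> i_s; have [iN|iN] := boolP (i < - N%:Z); first by rewrite fN ?mul0r.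
  rewrite [g _]gM ?mulr0 //.
  have [//|ige] := boolP (n%:Z - (N + M)%N%:Z - i < - M%:Z).
  exfalso; move/negP: i_s; apply; apply/mapP.
  by exists (absz (i + N%:Z)); rewrite ?mem_iota; lia.
rewrite /mulc (@fsbigE _ _ _ _ _ s) //; last by move=> i _; apply: supp.
rewrite pcoefM.
rewrite -(big_mkord xpredT
  (fun i => pcoef (sh N f) i * pcoef (sh M g) (n - i)%N)).
rewrite big_map /index_iota subn0 (eq_bigl xpredT) => [|k]; last exact: in_setT.
rewrite [LHS]big_seq [RHS]big_seq.
apply: eq_bigr => k; rewrite mem_iota => kn.
by congr (f _ * g _); lia.
Qed.

Fact lconst_bounded (c : R) : lbounded (fun j : int => if j == 0 then c else 0).
Proof. by exists 0%N => j; case: eqP => // ->. Qed.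
Definition lconst c := Laurent (lconst_bounded c).

Fact lmon_bounded (n : int) : lbounded (fun j : int => (j == n)%:R : R).
Proof. by exists `|n|%N => j jn; case: eqP => // jE; lia. Qed.
Definition lmon n := Laurent (lmon_bounded n).

Fact ladd_bounded f g : lbounded (fun j => lcoef f j + lcoef g j).
Proof.
have [N fN] := lcoefP f; have [M gM] := lcoefP g; exists (N + M)%N => j jlt.
by rewrite fN ?gM ?addr0 //; lia.
Qed.
Definition ladd f g := Laurent (ladd_bounded f g).

Fact lopp_bounded f : lbounded (fun j => - lcoef f j).
Proof. by have [N fN] := lcoefP f; exists N => j jlt; rewrite fN ?oppr0. Qed.
Definition lopp f := Laurent (lopp_bounded f).

Fact lmul_bounded f g :
  lbounded (fun j => \sum_(i \in [set: int]) lcoef f i * lcoef g (j - i)).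
Proof.
have [N fN] := lcoefP f; have [M gM] := lcoefP g; exists (N + M)%N => j.
exact: mulc_lt.
Qed.
Definition lmul f g := Laurent (lmul_bounded f g).

Fact laddA : associative ladd.
Proof. by move=> f g h; apply: laurentP => n /=; rewrite addrA. Qed.
Fact laddC : commutative ladd.
Proof. by move=> f g; apply: laurentP => n /=; rewrite addrC. Qed.
Fact ladd0 : left_id (lconst 0) ladd.
Proof. by move=> f; apply: laurentP => n /=; rewrite if_same add0r. Qed.
Fact laddN : left_inverse (lconst 0) lopp ladd.
Proof. by move=> f; apply: laurentP => n /=; rewrite if_same addNr. Qed.

HB.instance Definition _ :=
  GRing.isZmodule.Build (laurent R) laddA laddC ladd0 laddN.

Let lmulE N M f g (n : nat) : bnd N (lcoef f) -> bnd M (lcoef g) ->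
  lcoef (lmul f g) (n%:Z - (N + M)%N%:Z)
  = pcoef (sh N (lcoef f) * sh M (lcoef g)) n.
Proof. exact: mulc_sh. Qed.

Let lmul_sh N M f g : bnd N (lcoef f) -> bnd M (lcoef g) ->
  sh (N + M) (lcoef (lmul f g)) = sh N (lcoef f) * sh M (lcoef g).
Proof. by move=> fN gM; apply: pseriesP => n; rewrite -lmulE. Qed.

Let sh_inj N f g : bnd N (lcoef f) -> bnd N (lcoef g) ->
  sh N (lcoef f) = sh N (lcoef g) -> f = g.
Proof.
move=> fN gN fg; apply: laurentP => j.
have [jN|jN] := boolP (j < - N%:Z); first by rewrite fN ?gN.
have -> : j = (absz (j + N%:Z))%:Z - N%:Z by lia.
exact: (congr1 (fun F => pcoef F (absz (j + N%:Z))) fg).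
Qed.

Let bndM N M f g : bnd N (lcoef f) -> bnd M (lcoef g) ->
  bnd (N + M) (lcoef (lmul f g)).
Proof. by move=> fN gM j; apply: mulc_lt. Qed.

Fact lmulA : associative lmul.
Proof.
move=> f g h.
have [N fN] := lcoefP f; have [M gM] := lcoefP g; have [P hP] := lcoefP h.
apply: (@sh_inj (N + (M + P))).
- by do 2?apply: bndM.
- by rewrite addnA; do 2?apply: bndM.
rewrite lmul_sh //; last exact: bndM.
rewrite lmul_sh // mulrA addnA lmul_sh //; last exact: bndM.
by rewrite lmul_sh.
Qed.
Fact lmulC : commutative lmul.
Proof.
move=> f g; have [N fN] := lcoefP f; have [M gM] := lcoefP g.
apply: (@sh_inj (N + M)); first exact: bndM.
  by rewrite addnC; apply: bndM.
by rewrite lmul_sh // mulrC addnC lmul_sh.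
Qed.
Let sh0_const c : sh 0 (lcoef (lconst c)) = pconst c.
Proof. by apply: pseriesP => -[]. Qed.
Let bnd_const c : bnd 0 (lcoef (lconst c)).
Proof. by move=> j; rewrite /=; case: eqP => // ->. Qed.
Fact lmul1 : left_id (lconst 1) lmul.
Proof.
move=> f; have [N fN] := lcoefP f; apply: (@sh_inj (0 + N)) => //.
  exact: bndM.
by rewrite lmul_sh // sh0_const rmorph1 mul1r.
Qed.
Fact lmulDl : left_distributive lmul ladd.
Proof.
move=> f g h.
have [N fN] := lcoefP f; have [M gM] := lcoefP g; have [P hP] := lcoefP h.
have {}fN : bnd (N + M) (lcoef f) by apply: bndW fN; lia.
have {}gM : bnd (N + M) (lcoef g) by apply: bndW gM; lia.
have fgP : bnd (N + M) (lcoef (ladd f g)).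
  by move=> j jlt /=; rewrite fN ?gM ?addr0.
have shD Q f1 f2 :
    sh Q (lcoef (ladd f1 f2)) = sh Q (lcoef f1) + sh Q (lcoef f2).
  exact: pseriesP.
apply: (@sh_inj (N + M + P)); first exact: bndM.
  move=> j jlt; change (lcoef (lmul f h) j + lcoef (lmul g h) j = 0).
  by rewrite (bndM fN hP) // (bndM gM hP) // addr0.
by rewrite lmul_sh // !shD mulrDl !lmul_sh.
Qed.
Fact lone_neq0 : lconst 1 != 0.
Proof.
apply/eqP => /(congr1 (fun f => lcoef f 0)) /= /eqP.
by rewrite (oner_eq0 R).
Qed.

HB.instance Definition _ :=
  GRing.Zmodule_isComNzRing.Build (laurent R)
    lmulA lmulC lmul1 lmulDl lone_neq0.

Lemma lcoefM f g j :
  lcoef (f * g) j = \sum_(i \in [set: int]) lcoef f i * lcoef g (j - i).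
Proof. by []. Qed.

Fact lconst_is_zmod_morphism : zmod_morphism lconst.
Proof.
by move=> a b; apply: laurentP => n /=; case: eqP; rewrite // subr0.
Qed.
Fact lconst_is_monoid_morphism : monoid_morphism lconst.
Proof.
split=> // a b; apply: (@sh_inj (0 + 0)) => //; first exact: bndM.
by rewrite lmul_sh // !sh0_const rmorphM.
Qed.

HB.instance Definition _ :=
  GRing.isZmodMorphism.Build R (laurent R) lconst lconst_is_zmod_morphism.
HB.instance Definition _ :=
  GRing.isMonoidMorphism.Build R (laurent R) lconst lconst_is_monoid_morphism.

Lemma lmonD a b : lmon (a + b) = lmon a * lmon b.
Proof.
apply: laurentP => j; rewrite lcoefM (@fsbigE _ _ _ _ _ [:: a]) //.
  rewrite big_cons in_setT big_nil /= eqxx mul1r addr0.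
  by congr (_ %:R); lia.
by move=> i _; rewrite inE /= => /negPf ->; rewrite mul0r.
Qed.

Lemma lmon0 : lmon 0 = 1.
Proof. by apply: laurentP => j /=; case: eqP. Qed.

End Laurent.

(** Z[X_0, X_1, X_2, ...] *)
Definition zpoly : Type := {malg int[{cmonom nat}]}.
HB.instance Definition _ := GRing.ComNzRing.on zpoly.

Definition zX (i : nat) : zpoly := mkmalgU (ucm i) 1.

Section Evaluation.
Variables (S : comNzRingType) (v : nat -> S).

Definition cmeval (m : {cmonom nat}) : S := \prod_(i <- finsupp m) v i ^+ m i.

Lemma cmevalEw (d : {fset nat}) (m : {cmonom nat}) : (finsupp m `<=` d)%fset ->
  cmeval m = \prod_(i <- d) v i ^+ m i.
Proof.
move=> le; rewrite [LHS](big_fset_incl _ le) // => i _.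
by rewrite -cmE_eq0 => /eqP ->.
Qed.

Fact cmeval_mmorphism : mmorphism cmeval.
Proof.
split=> [m1 m2|]; last by rewrite /cmeval mdom1 big_seq_fset0.
pose d := (finsupp m1 `|` finsupp m2)%fset.
rewrite !(@cmevalEw d) ?fsubsetUl ?fsubsetUr ?mdomD ?fsubset_refl //.
by rewrite -big_split; apply: eq_bigr => i _; rewrite cmM exprD.
Qed.
HB.instance Definition _ :=
  isMultiplicative.Build {cmonom nat} S cmeval cmeval_mmorphism.

Definition zeval : zpoly -> S := mmap intr cmeval.
HB.instance Definition _ := GRing.RMorphism.copy zeval (mmap intr cmeval).

Lemma zeval_zX i : zeval (zX i) = v i.
Proof.
rewrite /zeval /zX mmapU mul1r.
rewrite (@cmevalEw [fset i]%fset) ?mdomU ?fsubset_refl //.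
by rewrite big_seq_fset1 cmUU expr1.
Qed.

End Evaluation.

Section Kronecker.

Let wgt D (m : {cmonom nat}) := (\sum_(i <- finsupp m) D ^ i * m i)%N.

Let wgtEw D n (m : {cmonom nat}) : (forall i, i \in finsupp m -> i < n)%N ->
  wgt D m = (\sum_(i < n) m i * D ^ i)%N.
Proof.
move=> mn; rewrite -(big_mkord xpredT (fun i => m i * D ^ i)%N).
rewrite (bigID (mem (finsupp m))) /= [X in (_ + X)%N]big1 ?addn0; last first.
  by move=> i; rewrite -cmE_eq0 => /eqP ->; rewrite mul0n.
rewrite -big_filter; rewrite /wgt; under eq_bigr do rewrite mulnC.
apply: perm_big; apply: uniq_perm.
- exact: fset_uniq.
- by rewrite filter_uniq ?iota_uniq.
- move=> i; rewrite mem_filter mem_index_iota /=.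
  by case: (boolP (i \in finsupp m)) => //= /mn ->.
Qed.

Let digits D n (a b : nat -> nat) :
  (forall i, a i < D)%N -> (forall i, b i < D)%N ->
  (\sum_(i < n) a i * D ^ i = \sum_(i < n) b i * D ^ i)%N ->
  forall i, (i < n)%N -> a i = b i.
Proof.
elim: n a b => [//|n IH] a b aD bD; rewrite !big_ord_recl /= !muln1.
have shift (c : nat -> nat) : (\sum_(i < n) c (bump 0 i) * D ^ bump 0 i
    = (\sum_(i < n) c i.+1 * D ^ i) * D)%N.
  by rewrite big_distrl; apply: eq_bigr => i _; rewrite /= expnSr mulnA.
rewrite !shift => e.
have e0 : a 0%N = b 0%N.
  by have := congr1 (modn^~ D) e;
    rewrite /= !(addnC _ (_ * D)) !modnMDl !modn_small.
case=> [//|i]; rewrite ltnS; apply: (IH (a \o succn) (b \o succn)) => //=.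
have D0 : (0 < D)%N by apply: leq_trans (aD 0%N).
by apply/eqP; rewrite -(eqn_pmul2r D0); move: e; rewrite e0 => /addnI ->.
Qed.

Let wgt_inj D (m1 m2 : {cmonom nat}) :
  (forall i, m1 i < D)%N -> (forall i, m2 i < D)%N ->
  wgt D m1 = wgt D m2 -> m1 = m2.
Proof.
move=> m1D m2D.
pose n := (\max_(i <- (finsupp m1 `|` finsupp m2)%fset) i).+1.
have lt_n i : i \in (finsupp m1 `|` finsupp m2)%fset -> (i < n)%N.
  by move=> im; rewrite ltnS; apply: (@leq_bigmax_seq _ _ xpredT id).
rewrite !(@wgtEw D n); first last.
- by move=> i im; apply: lt_n; rewrite in_fsetU im.
- by move=> i im; apply: lt_n; rewrite in_fsetU im orbT.
move=> e; apply/eqP/cmP => i.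
have [/lt_n|] := boolP (i \in (finsupp m1 `|` finsupp m2)%fset).
  exact: (digits m1D m2D e).
by rewrite in_fsetU negb_or -!cmE_eq0 => /andP[/eqP -> /eqP ->].
Qed.

Let kron D : zpoly -> {poly int} := zeval (fun i => 'X^(D ^ i)).

Let kron_eq0 D (p : zpoly) :
  (forall m i, m \in msupp p -> m i < D)%N -> kron D p = 0 -> p = 0.
Proof.
move=> pD p0; apply/malgP => m0; rewrite mcoeff0.
case: (msuppP p m0) => // m0p.
have := congr1 (fun q : {poly int} => q`_(wgt D m0)) p0; rewrite coef0 => <-.
rewrite /kron /zeval mmapE coef_sum (big_fsetD1 m0) //= big1_seq.
  rewrite addr0 /cmeval; under eq_bigr do rewrite -exprM.
  by rewrite -expr_sum mulrzl coefMrz coefXn eqxx intz.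
move=> m /= /fsetD1P [m_m0 mp].
rewrite /cmeval; under eq_bigr do rewrite -exprM.
rewrite -expr_sum mulrzl coefMrz coefXn.
case: eqP => [e|]; last by rewrite mul0rz.
by case/eqP: m_m0; apply/esym; apply: (@wgt_inj D) e => i; apply: pD.
Qed.

Let cm_lt_msize (p : zpoly) (m : {cmonom nat}) i :
  m \in msupp p -> (m i < mmeasure mdeg p)%N.
Proof.
move=> mp; apply: leq_ltn_trans (mmeasure_mnm_lt mdeg mp).
have [im|] := boolP (i \in finsupp m); last by rewrite -cmE_eq0 => /eqP ->.
by rewrite [leqRHS]mdegE (big_fsetD1 i) //= leq_addr.
Qed.

Fact zpoly_integral (p q : zpoly) : p * q = 0 -> (p == 0) || (q == 0).
Proof.
move=> pq0; pose D := (mmeasure mdeg p + mmeasure mdeg q)%N.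
have : kron D p * kron D q == 0 by rewrite -rmorphM pq0 rmorph0.
rewrite mulf_eq0 => /orP[] /eqP r0; apply/orP; [left|right];
  apply/eqP; apply: kron_eq0 r0 => m i mp;
  by have := cm_lt_msize i mp; rewrite /D; lia.
Qed.

End Kronecker.

Definition zpoly_unit : {pred zpoly} :=
  fun p => `[< exists q : zpoly, q * p = 1 >].
Definition zpoly_inv (p : zpoly) : zpoly :=
  if pselect (exists q : zpoly, q * p = 1) is left e then projT1 (cid e) else p.

Fact zpoly_mulVx : {in zpoly_unit, left_inverse 1 zpoly_inv *%R}.
Proof.
move=> p /asboolP pu; rewrite /zpoly_inv.
by case: pselect => // e; case: cid.
Qed.
Fact zpoly_unitPl (p q : zpoly) : q * p = 1 -> zpoly_unit p.
Proof. by move=> qp; apply/asboolP; exists q. Qed.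
Fact zpoly_inv_out : {in [predC zpoly_unit], zpoly_inv =1 id}.
Proof.
move=> p /negP pu; rewrite /zpoly_inv.
by case: pselect => // e; case: pu; apply/asboolP.
Qed.

HB.instance Definition _ :=
  GRing.ComNzRing_hasMulInverse.Build zpoly
    zpoly_mulVx zpoly_unitPl zpoly_inv_out.
HB.instance Definition _ :=
  GRing.ComUnitRing_isIntegral.Build zpoly zpoly_integral.

(** Here X_0 is t, X_1 is L = lambda_1, and X_i is lambda_i for i >= 2; an
    element of [ratfun] involves finitely many of the variables. *)
Definition ratfun : Type := {fraction zpoly}.
HB.instance Definition _ := GRing.Field.on ratfun.

Definition ratfrac (P Q : zpoly) : ratfun :=
  FracField.tofrac P / FracField.tofrac Q.

Definition rX (i : nat) : ratfun := FracField.tofrac (zX i).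
Definition rt : ratfun := rX 0.
Definition rL : ratfun := rX 1.

Definition zinvert : zpoly -> ratfun := zeval (fun i => (rX i)^-1).
HB.instance Definition _ :=
  GRing.RMorphism.copy zinvert (zeval (fun i => (rX i)^-1)).

(** the substitution X_i |-> X_i^-1 for all i, computed on a representative;
    see [invert_vars_frac] *)
Definition invert_vars (F : ratfun) : ratfun :=
  zinvert \n_(repr F) / zinvert \d_(repr F).

Section Inversion.

Let zmonM (m1 m2 : {cmonom nat}) :
  (mkmalgU (mmul m1 m2) 1 : zpoly) = mkmalgU m1 1 * mkmalgU m2 1.
Proof. by rewrite malgM_def fgmulUU mulr1. Qed.

Let zmon_cmeval (m : {cmonom nat}) : (mkmalgU m 1 : zpoly) = cmeval zX m.
Proof.
pose pw i n : {cmonom nat} := iter n (mmul (ucm i)) mone.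
have pwE i n j : pw i n j = (n * (i == j))%N.
  elim: n => [|n IH]; first by rewrite cm1.
  by rewrite /pw iterS cmM IH cmU mulSn.
have zXn i n : mkmalgU (pw i n) 1 = zX i ^+ n.
  by elim: n => [|n IH]; rewrite ?expr0 // exprS -IH -zmonM.
have prodE (r : seq nat) (F : nat -> {cmonom nat}) j :
    (\big[mmul/mone]_(i <- r) F i) j = (\sum_(i <- r) F i j)%N.
  by elim: r => [|i r IH]; rewrite ?big_nil ?cm1 // !big_cons cmM IH.
have {1}-> : m = \big[mmul/mone]_(i <- finsupp m) pw i (m i).
  apply/eqP/cmP => j; rewrite prodE; under eq_bigr do rewrite pwE.
  have [jm|] := boolP (j \in finsupp m).
    rewrite (big_fsetD1 j) //= eqxx muln1 big1_seq ?addn0 // => i /=.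
    by case/fsetD1P => /negPf -> _; rewrite muln0.
  move=> jm; have := jm; rewrite -cmE_eq0 => /eqP ->.
  rewrite big1_seq // => i /= im; case: eqP => [e|]; last by rewrite muln0.
  by rewrite -e im in jm.
rewrite /cmeval; elim: (enum_fset _) => [|i r IH]; first by rewrite !big_nil.
by rewrite !big_cons zmonM IH zXn.
Qed.

Let tofrac_mon c (m : {cmonom nat}) :
  FracField.tofrac (mkmalgU m c : zpoly) = c%:~R * cmeval rX m.
Proof.
rewrite -[c in LHS]intz raddfMz rmorphMz /= mulrzl; congr (_ *~ _).
by rewrite zmon_cmeval rmorph_prod; apply: eq_bigr => i _; rewrite rmorphXn.
Qed.

Lemma zinvert_eq0 (p : zpoly) : zinvert p = 0 -> p = 0.
Proof.
have [M divM] : exists M : {cmonom nat},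
    forall m, m \in msupp p -> mmul (divcm M m) m = M.
  exists (\big[mmul/mone]_(m <- msupp p) m) => m mp.
  apply/eqP/cmP => i; rewrite cmM divcmE subnK //.
  by rewrite (big_fsetD1 m) //= cmM leq_addr.
have rXn0 i : rX i != 0.
  by rewrite tofrac_eq0 /zX monalgU_eq0 oner_eq0.
have rinv m : cmeval (fun i => (rX i)^-1) m * cmeval rX m = 1.
  rewrite -big_split big1 //= => i _.
  by rewrite exprVn mulVf // expf_neq0.
pose q : zpoly := \sum_(m <- msupp p) mkmalgU (divcm M m) p@_m.
move=> p0; have q0 : q = 0.
  apply/eqP; rewrite -tofrac_eq0 /q rmorph_sum /=; apply/eqP.
  transitivity (zinvert p * cmeval rX M); last by rewrite p0 mul0r.
  rewrite /zinvert /zeval mmapE mulr_suml; apply: eq_big_seq => m mp.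
  rewrite tofrac_mon -mulrA; congr (_ * _).
  have -> : cmeval rX M = cmeval rX (divcm M m) * cmeval rX m.
    by rewrite -mmorphM divM.
  by rewrite mulrCA rinv mulr1.
apply/malgP => m0; rewrite mcoeff0; case: (msuppP p m0) => // m0p.
have := congr1 (mcoeff (divcm M m0)) q0; rewrite mcoeff0 => <-.
rewrite /q raddf_sum /=; under eq_bigr do rewrite mcoeffU.
rewrite (big_fsetD1 m0) //= eqxx mulr1n big1_seq ?addr0 // => m /=.
case/fsetD1P => mm0 mp; case: eqP => // e.
case/eqP: mm0; apply/eqP/cmP => i.
have /eqP/cmP/(_ i) : mmul (divcm M m) m = mmul (divcm M m0) m0
  by rewrite !divM.
by rewrite !cmM e => /addnI.
Qed.

Local Open Scope quotient_scope.

Lemma frac_numden (R : idomainType) (F : {fraction R}) :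
  F = FracField.tofrac \n_(repr F) / FracField.tofrac \d_(repr F).
Proof.
rewrite -[LHS]reprK; move: (repr F) => x.
unlock FracField.tofrac.
rewrite -[X in _ = _ * X]FracField.pi_inv.
rewrite -[RHS]FracField.pi_mul; congr (\pi _).
rewrite /FracField.mulf /FracField.invf !numden_Ratio
  ?oner_eq0 ?denom_ratioP //.
by rewrite mulr1 mul1r Ratio_numden.
Qed.

Lemma invert_vars_frac (P Q : zpoly) : Q != 0 ->
  invert_vars (ratfrac P Q) = zinvert P / zinvert Q.
Proof.
have nz (p : zpoly) : p != 0 -> zinvert p != 0.
  by apply: contra_neq; apply: zinvert_eq0.
have gen (n d : zpoly) : d != 0 -> Q != 0 -> ratfrac P Q = ratfrac n d ->
    zinvert n / zinvert d = zinvert P / zinvert Q.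
  move=> d0 Q0 /eqP; rewrite /ratfrac eqr_div ?tofrac_eq0 //.
  rewrite -!tofracM tofrac_eq => /eqP e.
  apply/eqP; rewrite (eqr_div _ _ (nz _ d0) (nz _ Q0)).
  by rewrite -(rmorphM zinvert n Q) -(rmorphM zinvert P d) e.
move=> Q0; apply: gen => //; first exact: denom_ratioP.
exact: frac_numden.
Qed.

End Inversion.

(** Z[lambda_2, lambda_3, ...]((L^-1))[[t]]: here the variable X_i of [zpoly] is
    lambda_(i+2), and the variable of the Laurent series is L^-1, so that [lcoef]
    at j is the coefficient of L^(-j). *)
Definition gring : Type := pseries (laurent zpoly).
HB.instance Definition _ := GRing.ComNzRing.on gring.

Definition gt : gring := pvar _.

(** L^n for an integer n *)
Definition gLexp (n : int) : gring := pconst (lmon zpoly (- n)).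
Definition gL : gring := gLexp 1.

Definition glam (k : nat) : gring :=
  if k == 1%N then gL else pconst (lconst (zX (k - 2))).

(** coefficientwise convergence in t for the L^-1-adic topology: for each i the
    coefficients of t^i eventually agree modulo L^(-N) *)
Definition gcvg (u : nat -> gring) (s : gring) : Prop :=
  forall (i : nat) (N : int), exists M0 : nat, forall M : nat, (M0 <= M)%N ->
    forall j : int, j < N -> lcoef (pcoef (u M) i) j = lcoef (pcoef s i) j.

(** values at indices k = 0 or m = 0 are irrelevant *)
Definition G_family (G : nat -> nat -> gring) : Prop :=
  [/\ G 1%N 1%N = (gL - 1) ^+ 2 * gLexp (- 2),
      forall k m : nat, (0 < k)%N -> (0 < m)%N -> G k m = G m k,
      forall k m : nat, (0 < k)%N -> (k < m)%N ->
        G k m = gt ^+ (k * (k - 1)) * gLexp (- k%:Z) * G k (m - k)%N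
    & forall k : nat, (0 < k)%N ->
        exists2 s : gring,
          gcvg (fun M => \sum_(k.+1 <= m < M) G k m) s
          & G k k = (glam k - 1) * s].

Definition gexpand : zpoly -> gring :=
  zeval (fun i => if i == 0%N then gt else glam i).
HB.instance Definition _ := GRing.RMorphism.copy gexpand
  (zeval (fun i => if i == 0%N then gt else glam i)).

(** g is the expansion of F = P / Q in [gring]; Q need not be invertible there,
    so this is expressed as Q g = P *)
Definition is_expansion (g : gring) (F : ratfun) : Prop :=
  exists P Q : zpoly,
    [/\ Q != 0, F = ratfrac P Q & gexpand Q * g = gexpand P].

(* Main.v *)
(** Put q_k = t^(k(k-1)) L^(-k). Shifting the convergent series over m > k by k
    terms turns the diagonal relation, for k > 1, into
      (1 - lambda_k q_k) G_{k,k} = (lambda_k - 1) q_k \sum_(a < k) G_{k,a},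
    so every G_{k,m} is rational by the Euclidean algorithm, and its rational
    function is unique because the expansion map is injective on polynomials.
    The functional equation follows by induction on k + m. In the diagonal case
    the sum over a < k is self-reciprocal up to a monomial: since
    G_{k,a} = q_a G_{a,k-a} and G_{k,k-a} = q_{k-a} G_{k-a,a}, inversion carries
    its a-th term to a monomial, independent of a, times its (k-a)-th term. *)
Require Import Defs.
From mathcomp Require Import all_boot all_order all_algebra.
From HB Require Import structures.
From mathcomp Require Import finmap zify ring.
From mathcomp Require Import boolp classical_sets fsbigop.
From mathcomp.multinomials Require Import monalg.

Import GRing.Theory.
Local Open Scope ring_scope.

(** * Coefficients of products with powers of t and L *)

Lemma pcoef_pvarX (R : comNzRingType) (a i : nat) (f : pseries R) :
  pcoef (pvar R ^+ a * f) i = if (a <= i)%N then pcoef f (i - a) else 0.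
Proof.
have step (h : pseries R) n :
    pcoef (pvar R * h) n = if n is n'.+1 then pcoef h n' else 0.
  case: n => [|n]; rewrite pcoefM big_ord_recl /= mul0r add0r ?big_ord0 //.
  rewrite big_ord_recl /= mul1r subSS subn0 big1 ?addr0 // => j _.
  by rewrite mul0r.
elim: a i => [|a IH] i; first by rewrite mul1r subn0.
by rewrite exprS -mulrA step; case: i.
Qed.

Lemma pcoef_pconstM (R : comNzRingType) (c : R) (f : pseries R) i :
  pcoef (pconst c * f) i = c * pcoef f i.
Proof.
rewrite pcoefM big_ord_recl /= subn0 big1 ?addr0 // => j _.
by rewrite mul0r.
Qed.

Lemma lcoef_lmonM (R : comNzRingType) (a : int) (f : laurent R) j :
  lcoef (lmon R a * f) j = lcoef f (j - a).
Proof.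
rewrite lcoefM (@fsbigE _ _ _ _ _ [:: a]) //.
  by rewrite big_cons in_setT big_nil /= eqxx mul1r addr0.
by move=> i _; rewrite inE /= => /negPf ->; rewrite mul0r.
Qed.

Lemma lcoef_shift (a : nat) (b : int) (g : gring) i j :
  lcoef (pcoef (gt ^+ a * gLexp b * g) i) j
  = if (a <= i)%N then lcoef (pcoef g (i - a)) (j + b) else 0.
Proof.
rewrite -mulrA pcoef_pvarX; case: leqP => // _; last by rewrite /= if_same.
by rewrite pcoef_pconstM lcoef_lmonM opprK.
Qed.

Lemma gLexpD a b : gLexp (a + b) = gLexp a * gLexp b.
Proof. by rewrite /gLexp opprD lmonD rmorphM. Qed.

Lemma gLexp0 : gLexp 0 = 1.
Proof. by rewrite /gLexp oppr0 lmon0 rmorph1. Qed.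

Lemma gLX n : gL ^+ n = gLexp n.
Proof.
elim: n => [|n IH]; first by rewrite gLexp0.
by rewrite exprS IH -gLexpD; congr gLexp; lia.
Qed.

(** * Injectivity of the expansion map on polynomials *)

Definition gcoef (a : nat) (b : int) (s : {cmonom nat}) (g : gring) : int :=
  mcoeff s (lcoef (pcoef g a) (- b)).

Fact gcoef_is_zmod_morphism a b s : zmod_morphism (gcoef a b s).
Proof. by move=> f g; rewrite /gcoef /= mcoeffB. Qed.
HB.instance Definition _ a b s :=
  GRing.isZmodMorphism.Build gring int (gcoef a b s) (gcoef_is_zmod_morphism a b s).

Definition gmon (a : nat) (b : int) (s : {cmonom nat}) : gring :=
  gt ^+ a * gLexp b * pconst (lconst (mkmalgU s 1 : zpoly)).

(** The monomials [gmon] are dual to the functionals [gcoef]. The sign of [- b] in [gcoef] arises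
    because Laurent coefficients are indexed by powers of L^-1. *)
Lemma gcoef_gmon a b s a' b' s' :
  gcoef a b s (gmon a' b' s') = [&& a' == a, b' == b & s' == s]%:R.
Proof.
have m0 : mcoeff s (0 : zpoly) = 0 by exact: mcoeff0.
have l0 x : mcoeff s (lcoef (0 : laurent zpoly) x) = 0 by rewrite /= if_same.
rewrite /gcoef lcoef_shift; case: (leqP a' a) => aa; last first.
  by rewrite [LHS]m0; case: eqP => // e; lia.
rewrite /=; case: (eqVneq (a - a')%N 0%N) => [e|e]; last first.
  by rewrite [LHS]l0; case: eqP => // e'; lia.
rewrite (_ : (a' == a)) /=; last by lia.
case: (eqVneq b' b) => [->|ne] /=.
  by rewrite addNr /= mcoeffU1.
by rewrite ifN ?[LHS]m0 //; lia.
Qed.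

Lemma gmonM a b s a' b' s' :
  gmon a b s * gmon a' b' s' = gmon (a + a') (b + b') (mmul s s').
Proof.
rewrite /gmon exprD gLexpD.
have -> : mkmalgU (mmul s s') 1 = mkmalgU s 1 * mkmalgU s' 1 :> zpoly.
  by rewrite malgM_def fgmulUU mulr1.
rewrite (rmorphM (@lconst zpoly)) (rmorphM (@pconst _)) mulrACA.
by rewrite [X in X * _ = _]mulrACA.
Qed.

Definition gvar (i : nat) : gring := if i == 0%N then gt else glam i.

Lemma gvarE i :
  gvar i = gmon (i == 0%N) (i == 1%N)%:Z (if (1 < i)%N then ucm (i - 2)%N else mone).
Proof.
have e : pconst (lconst (mkmalgU mone 1 : zpoly)) = 1.
  by rewrite -[mkmalgU mone 1]/(1 : zpoly) !rmorph1.
rewrite /gvar /gmon /glam; case: i => [|[|i]] /=.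
- by rewrite e gLexp0 !mulr1.
- by rewrite e mulr1 mul1r.
- by rewrite gLexp0 expr0 !mul1r; congr (pconst (lconst _)).
Qed.

Lemma gvarX i n : exists s : {cmonom nat},
  gvar i ^+ n = gmon (n * (i == 0%N)) (n * (i == 1%N))%N s
  /\ forall j, s j = (n * (i == j.+2))%N.
Proof.
elim: n => [|n [s [IH sE]]].
  exists mone; split=> [|j]; last by rewrite cm1.
  by rewrite /gmon gLexp0 !mul1r -[mkmalgU mone 1]/(1 : zpoly) !rmorph1.
eexists; split; first by rewrite exprS IH gvarE gmonM mulSn PoszD; congr gmon; lia.
move=> j; rewrite cmM sE mulSn; congr addn.
by case: i {IH sE} => [|[|i]] /=; rewrite ?cm1 // cmU subn2.
Qed.

(** The exponents of t, L and lambda_(j+2) in the image recover m at 0, 1 and j+2, so distinct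
    monomials keep distinct images. *)
Lemma cmeval_gvar (m : {cmonom nat}) : exists s : {cmonom nat},
  cmeval gvar m = gmon (m 0%N) (m 1%N) s /\ forall j, s j = m j.+2.
Proof.
have gen (r : seq nat) : exists s : {cmonom nat},
    \prod_(i <- r) gvar i ^+ m i
    = gmon (\sum_(i <- r) m i * (i == 0%N)) (\sum_(i <- r) m i * (i == 1%N))%N s
    /\ forall j, s j = (\sum_(i <- r) m i * (i == j.+2))%N.
  elim: r => [|i r [s [IH sE]]].
    exists mone; split=> [|j]; last by rewrite cm1 big_nil.
    rewrite !big_nil /gmon gLexp0 !mul1r.
    by rewrite -[mkmalgU mone 1]/(1 : zpoly) !rmorph1.
  have [s' [iE s'E]] := gvarX i (m i).
  exists (mmul s' s); split.
    by rewrite !big_cons IH iE gmonM -PoszD; congr gmon.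
  by move=> j; rewrite cmM big_cons sE s'E.
have supp j : (\sum_(i <- finsupp m) m i * (i == j))%N = m j.
  have [jm|] := boolP (j \in finsupp m).
    rewrite (big_fsetD1 j) //= eqxx muln1 big1_seq ?addn0 // => i /=.
    by case/fsetD1P => /negPf -> _; rewrite muln0.
  move=> jm; have := jm; rewrite -cmE_eq0 => /eqP ->.
  rewrite big1_seq // => i /= im; case: eqP => [e|]; last by rewrite muln0.
  by rewrite -e im in jm.
have [s [mE sE]] := gen (finsupp m).
by exists s; split=> [|j]; rewrite ?sE ?supp // -(supp 0%N) -(supp 1%N).
Qed.

(** The functional [gcoef] dual to the image of a monomial m0 kills the images of all other
    monomials, so it reads the coefficient of p at m0 off the expansion of p. *)
Lemma gexpand_eq0 (p : zpoly) : gexpand p = 0 -> p = 0.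
Proof.
move=> p0; apply/malgP => m0; rewrite mcoeff0.
case: (msuppP p m0) => // m0p.
have [s0 [_ s0E]] := cmeval_gvar m0.
have := congr1 (gcoef (m0 0%N) (m0 1%N) s0) p0; rewrite raddf0 => <-.
rewrite /gexpand /zeval mmapE raddf_sum (big_fsetD1 m0) //=.
have term (m : {cmonom nat}) :
    gcoef (m0 0%N) (m0 1%N) s0 ((p@_m)%:~R * cmeval gvar m) = p@_m *+ (m == m0).
  have [s [-> sE]] := cmeval_gvar m.
  rewrite mulrzl raddfMz [X in X *~ _]gcoef_gmon.
  suff -> : [&& (m 0%N == m0 0%N), (m 1%N : int) == m0 1%N & s == s0] = (m == m0).
    by case: eqP; rewrite ?mulr0n ?mul0rz // intz.
  apply/and3P/eqP => [[/eqP e0 /eqP [e1] /eqP es]|mE]; last first.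
    by rewrite mE in sE *; split=> //; apply/cmP => j; rewrite sE s0E.
  by apply/eqP/cmP => -[|[|i]] //; rewrite -sE -s0E es.
rewrite [X in X + _]term eqxx mulr1n big1_seq ?addr0 // => m /=.
by case/fsetD1P => /negPf mm0 mp; rewrite [LHS]term mm0.
Qed.

(** * The functional equation over an abstract field with an inverting endomorphism *)

Section Reciprocity.
Variables (K : fieldType) (inv : {rmorphism K -> K}) (t L : K).
Variables (lam : nat -> K) (R : nat -> nat -> K).

(** Integer exponents avoid truncated subtraction, and identities between monomials become ring
    identities between exponents. *)
Let mu (a b : int) : K := t ^ a * L ^ b.
Let q (k : nat) : K := mu (k%:Z * (k%:Z - 1)) (- k%:Z).

Hypotheses (t0 : t != 0) (L0 : L != 0) (lam0 : forall k, (1 < k)%N -> lam k != 0).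
Hypotheses (inv_t : inv t = t^-1) (inv_L : inv L = L^-1)
  (inv_lam : forall k, (1 < k)%N -> inv (lam k) = (lam k)^-1).
Hypothesis R11 : R 1 1 = (L - 1) ^+ 2 / L ^+ 2.
Hypothesis Rsym : forall k m, (0 < k)%N -> (0 < m)%N -> R k m = R m k.
Hypothesis Radd : forall a b, (0 < a)%N -> (0 < b)%N -> R a (a + b) = q a * R a b.
Hypothesis lamq : forall k, (1 < k)%N -> 1 - lam k * q k != 0.
Hypothesis Rdiag : forall k, (1 < k)%N ->
  (1 - lam k * q k) * R k k = (lam k - 1) * q k * \sum_(1 <= a < k) R k a.

Let muM a b c d : mu a b * mu c d = mu (a + c) (b + d).
Proof. by rewrite /mu !expfzDr // mulrACA. Qed.

Let muMA a b c d x : mu a b * (mu c d * x) = mu (a + c) (b + d) * x.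
Proof. by rewrite mulrA muM. Qed.

Let inv_mu a b : inv (mu a b) = mu (- a) (- b).
Proof. by rewrite /mu rmorphM !fmorphXz inv_t inv_L !exprz_inv. Qed.

Let muV a b : (mu a b)^-1 = mu (- a) (- b).
Proof. by rewrite /mu invfM !invr_expz. Qed.

Lemma reciprocity k m : (0 < k)%N -> (0 < m)%N ->
  inv (R k m) =
    mu (- (2 * (k%:Z - 1) * (m%:Z - 1))) (2 * k%:Z + 2 * m%:Z - 2) * R k m.
Proof.
move: {2}(k + m)%N (leqnn (k + m)) => n.
elim: n k m => [|n IH] k m; first by case: k.
wlog: k m / (k <= m)%N => [hw le_n k0 m0|].
  have [km|/ltnW mk] := leqP k m; first exact: hw.
  rewrite Rsym // hw // 1?addnC //; congr (mu _ _ * _); ring.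
rewrite leq_eqVlt => /orP [/eqP <-{m}|km] le_n k0 m0; last first.
  have [b bE] : exists b, m = (k + b)%N by exists (m - k)%N; lia.
  subst m; have b0 : (0 < b)%N by lia.
  (* Inversion replaces q_k by its inverse, so passing from (k,b) to (k,k+b) multiplies the monomial
     by q_k^-2; this matches (k-1)(k+b-1) - (k-1)(b-1) = k(k-1). *)
  rewrite Radd // rmorphM inv_mu IH //; last by lia.
  by rewrite /q !muMA PoszD; congr (mu _ _ * _); ring.
have [k1|k1] := leqP k 1.
  have -> : k = 1%N by lia.
  rewrite R11 !rmorphM fmorphV !rmorphXn rmorphB rmorph1 inv_L /mu expr0z mul1r.
  rewrite -[L ^ _]/(L ^+ 2); field.
  by rewrite L0 oner_neq0.
pose S := \sum_(1 <= a < k) R k a.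
(* The ratio of the inverted term [R k a] to the term [R k (k - a)]. In the exponent of t,
   -2(k-1)(a-1) + a(a-1) - (k-a)(k-a-1), and in that of L, 2k+2a-2 - a + (k-a), the index a
   cancels. *)
pose c := mu (- ((k%:Z - 1) * (k%:Z - 2))) (3 * k%:Z - 2).
have inv_S : inv S = c * S.
  rewrite rmorph_sum mulr_sumr /= [RHS]big_nat_rev /=.
  rewrite [LHS]big_nat [RHS]big_nat; apply: eq_bigr => a /andP[a0 ak].
  rewrite IH //; last by lia.
  have [b bE] : exists b, k = (a + b)%N by exists (k - a)%N; lia.
  have b0 : (0 < b)%N by lia.
  have -> : (1 + k - a.+1)%N = b by lia.
  (* Both terms reduce to [R a b]: one carries the factor q_a, the other q_b. *)
  rewrite /c bE !(Rsym (a + b)%N) //; try by lia.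
  rewrite Radd // [in R b _]addnC Radd // (Rsym b) //.
  by rewrite /q !muMA PoszD; congr (mu _ _ * _); ring.
have q0 : q k != 0 by rewrite mulf_neq0 // expfz_neq0.
have inv_q : inv (q k) = (q k)^-1 by rewrite inv_mu muV.
(* Inverting the diagonal relation gives the factor 1 - 1/(lambda_k q_k); multiplying by -lambda_k
   q_k restores 1 - lambda_k q_k, the coefficient in the original relation. *)
have inv_diag : (1 - lam k * q k) * inv (R k k) = (lam k - 1) * (c * S).
  move: (congr1 inv (Rdiag _ k1)) inv_q q0; rewrite -/S; move: (q k) => x + inv_x x0.
  rewrite !rmorphM !rmorphB !rmorphM !rmorph1 inv_S inv_lam // inv_x => e.
  have := congr1 ( *%R (- (lam k * x))) e.
  have -> y : - (lam k * x) * ((1 - (lam k)^-1 / x) * y) = (1 - lam k * x) * y.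
    by field; rewrite x0 lam0.
  by move=> ->; field; rewrite x0 lam0.
apply: (mulfI (lamq _ k1)).
(* Comparison with the original relation leaves the ratio c/q_k, whose exponents are -2(k-1)^2 and
   4k-2. *)
have -> : (1 - lam k * q k) * inv (R k k)
    = c / q k * ((1 - lam k * q k) * R k k).
  by rewrite inv_diag Rdiag // -/S; field.
rewrite mulrCA /c /q muV muM; congr (_ * (mu _ _ * _)); ring.
Qed.

End Reciprocity.

(** * Arithmetic of fractions, and inversion of the variables as a ring morphism *)

Lemma ratfracE (F : ratfun) : exists P Q : zpoly, Q != 0 /\ F = ratfrac P Q.
Proof.
exists \n_(repr F), \d_(repr F); split; last exact: frac_numden.
exact: denom_ratioP.
Qed.

Lemma zinvert_neq0 (p : zpoly) : p != 0 -> zinvert p != 0.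
Proof. by apply: contra_neq; apply: zinvert_eq0. Qed.

Lemma subf_div (K : fieldType) (x y x' y' : K) : y != 0 -> y' != 0 ->
  x / y - x' / y' = (x * y' - x' * y) / (y * y').
Proof. by move=> y0 y'0; rewrite -mulNr addf_div // mulNr. Qed.

Section FracArithmetic.
Variable D : idomainType.
Implicit Types a b c d : D.
Local Notation "x %:F" := (FracField.tofrac x).

Lemma tofrac_divB a b c d : b != 0 -> d != 0 ->
  a%:F / b%:F - c%:F / d%:F = (a * d - c * b)%:F / (b * d)%:F.
Proof. by move=> b0 d0; rewrite subf_div ?tofrac_eq0 // tofracB !tofracM. Qed.

Lemma tofrac_divD a b c d : b != 0 -> d != 0 ->
  a%:F / b%:F + c%:F / d%:F = (a * d + c * b)%:F / (b * d)%:F.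
Proof. by move=> b0 d0; rewrite addf_div ?tofrac_eq0 // tofracD !tofracM. Qed.

Lemma tofrac_divM a b c d :
  a%:F / b%:F * (c%:F / d%:F) = (a * c)%:F / (b * d)%:F.
Proof. by rewrite mulf_div !tofracM. Qed.

Lemma eq_tofrac_div a b c d : b != 0 -> d != 0 ->
  a * d = c * b -> a%:F / b%:F = c%:F / d%:F.
Proof.
move=> b0 d0 e; apply/eqP; rewrite eqr_div ?tofrac_eq0 // -!tofracM.
by rewrite e.
Qed.

End FracArithmetic.

Section MorphismFractions.
Variables (D S : comNzRingType) (f : {rmorphism D -> S}).
Implicit Types (P Q : D) (g : S).

(** The relation [f Q * g = f P] says that g represents P/Q through f without inverting [f Q]. Here
    both products equal [f Q * f Q' * g]. *)
Lemma rmorph_frac_unique P Q P' Q' g : f Q * g = f P -> f Q' * g = f P' ->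
  f (P * Q' - P' * Q) = 0.
Proof. by move=> e e'; rewrite rmorphB !rmorphM -e -e' /=; ring. Qed.

Lemma rmorph_fracD P Q P' Q' g g' : f Q * g = f P -> f Q' * g' = f P' ->
  f (Q * Q') * (g + g') = f (P * Q' + P' * Q).
Proof. by move=> e e'; rewrite rmorphD !rmorphM -e -e' /=; ring. Qed.

Lemma rmorph_fracM P Q P' Q' g g' : f Q * g = f P -> f Q' * g' = f P' ->
  f (Q * Q') * (g * g') = f (P * P').
Proof. by move=> e e'; rewrite !rmorphM -e -e' /=; ring. Qed.

Lemma rmorph_frac_div P Q Q' g : f Q' * (f Q * g) = f P -> f (Q * Q') * g = f P.
Proof. by move=> <-; rewrite rmorphM mulrCA mulrA. Qed.

End MorphismFractions.

Lemma rmorph_binomial (D S : comNzRingType) (f : {rmorphism D -> S})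
    (a b c : D) (x y z : S) n p : f a = x -> f b = y -> f c = z ->
  f (a ^+ n - b * c ^+ p) = x ^+ n - y * z ^+ p.
Proof. by move=> <- <- <-; rewrite rmorphB rmorphM !rmorphXn. Qed.

Lemma rmorph_expn (D S : comNzRingType) (f : {rmorphism D -> S}) (a : D) (x : S) n :
  f a = x -> f (a ^+ n) = x ^+ n.
Proof. by move=> <-; rewrite rmorphXn. Qed.

Lemma rmorph_divB (D : comNzRingType) (K : fieldType) (f : {rmorphism D -> K})
    (a b c d : D) : f b != 0 -> f d != 0 ->
  f (a * d - c * b) / f (b * d) = f a / f b - f c / f d.
Proof. by move=> b0 d0; rewrite subf_div // rmorphB !rmorphM. Qed.

Lemma rmorph_divM (D : comNzRingType) (K : fieldType) (f : {rmorphism D -> K})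
    (a b c d : D) : f (a * c) / f (b * d) = f a / f b * (f c / f d).
Proof. by rewrite mulf_div !rmorphM. Qed.

Lemma ratfracB (P Q P' Q' : zpoly) : Q != 0 -> Q' != 0 ->
  ratfrac P Q - ratfrac P' Q' = ratfrac (P * Q' - P' * Q) (Q * Q').
Proof.
exact: tofrac_divB.
Qed.

Lemma ratfracM (P Q P' Q' : zpoly) :
  ratfrac P Q * ratfrac P' Q' = ratfrac (P * P') (Q * Q').
Proof. exact: tofrac_divM. Qed.

(** By [invert_vars_frac] the value does not depend on the representative, so fractions may be
    combined over a common denominator. Being a morphism lets [invert_vars] serve as [inv] in
    [reciprocity]. *)
Fact invert_vars_is_zmod_morphism : zmod_morphism invert_vars.
Proof.
move=> F F'; have [P [Q [Q0 ->]]] := ratfracE F.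
have [P' [Q' [Q'0 ->]]] := ratfracE F'.
rewrite ratfracB // !invert_vars_frac ?mulf_neq0 //.
by apply: (rmorph_divB _ _ zinvert); apply: zinvert_neq0.
Qed.

Fact invert_vars_is_monoid_morphism : monoid_morphism invert_vars.
Proof.
split=> [|F F'].
  rewrite -[1 in LHS](divr1 1) -tofrac1 [LHS]invert_vars_frac ?oner_neq0 //.
  by rewrite (rmorph1 zinvert) divr1.
have [P [Q [Q0 ->]]] := ratfracE F.
have [P' [Q' [Q'0 ->]]] := ratfracE F'.
rewrite ratfracM // !invert_vars_frac ?mulf_neq0 //.
exact: (rmorph_divM _ _ zinvert).
Qed.

HB.instance Definition _ :=
  GRing.isZmodMorphism.Build ratfun ratfun invert_vars invert_vars_is_zmod_morphism.
HB.instance Definition _ :=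
  GRing.isMonoidMorphism.Build ratfun ratfun invert_vars
    invert_vars_is_monoid_morphism.

Lemma invert_vars_rX i : invert_vars (rX i) = (rX i)^-1.
Proof.
rewrite -[rX i in LHS]divr1 -tofrac1 [LHS]invert_vars_frac ?oner_neq0 //.
apply: etrans (divr1 _).
exact: (congr2 (fun x y => x / y) (zeval_zX _ i) (rmorph1 zinvert)).
Qed.

Lemma rX_neq0 i : rX i != 0.
Proof. by rewrite tofrac_eq0 /zX monalgU_eq0 oner_eq0. Qed.

(** * Uniqueness and closure properties of expansions *)

Lemma is_expansion_unique g F F' : is_expansion g F -> is_expansion g F' -> F = F'.
Proof.
case=> P [Q [Q0 -> e]] [P' [Q' [Q'0 -> e']]].
apply: eq_tofrac_div Q0 Q'0 _; apply/eqP; rewrite -subr_eq0; apply/eqP/gexpand_eq0.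
exact: (rmorph_frac_unique _ _ gexpand _ _ _ _ g).
Qed.

Lemma is_expansion_zpoly (P : zpoly) : is_expansion (gexpand P) (FracField.tofrac P).
Proof.
exists P, 1; split; rewrite ?oner_neq0 //; first by rewrite /ratfrac tofrac1 divr1.
by rewrite (rmorph1 gexpand) mul1r.
Qed.

Lemma is_expansionD g F g' F' : is_expansion g F -> is_expansion g' F' ->
  is_expansion (g + g') (F + F').
Proof.
case=> P [Q [Q0 -> e]] [P' [Q' [Q'0 -> e']]].
exists (P * Q' + P' * Q), (Q * Q'); split; first by rewrite mulf_neq0.
  exact: tofrac_divD.
exact: (rmorph_fracD _ _ gexpand).
Qed.

Lemma is_expansionM g F g' F' : is_expansion g F -> is_expansion g' F' ->
  is_expansion (g * g') (F * F').
Proof.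
case=> P [Q [Q0 -> e]] [P' [Q' [Q'0 -> e']]].
exists (P * P'), (Q * Q'); split; [by rewrite mulf_neq0|exact: tofrac_divM|].
exact: (rmorph_fracM _ _ gexpand).
Qed.

Lemma is_expansion_sum (I : eqType) (r : seq I) (g : I -> gring) (F : I -> ratfun) :
  {in r, forall i, is_expansion (g i) (F i)} ->
  is_expansion (\sum_(i <- r) g i) (\sum_(i <- r) F i).
Proof.
elim: r => [|i r IH] gF.
  rewrite !big_nil; have := is_expansion_zpoly 0.
  by rewrite tofrac0 (rmorph0 gexpand).
rewrite !big_cons; apply: is_expansionD; first by apply: gF; rewrite mem_head.
by apply: IH => j jr; apply: gF; rewrite inE jr orbT.
Qed.

(** Turns a linear equation for g into its rationality: Q moves into the denominator, and its
    expansion is never inverted. *)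
Lemma is_expansion_div (Q : zpoly) g h F : Q != 0 -> gexpand Q * g = h ->
  is_expansion h F -> is_expansion g (F / FracField.tofrac Q).
Proof.
move=> Q0 <- [P' [Q' [Q'0 -> e]]].
exists P', (Q * Q'); split; first by rewrite mulf_neq0.
  by rewrite /ratfrac tofracM invfM mulrA mulrAC.
exact: (rmorph_frac_div _ _ gexpand).
Qed.

Lemma gexpand_t : gexpand (zX 0) = gt.
Proof. exact: zeval_zX. Qed.

Lemma gexpand_lam k : (0 < k)%N -> gexpand (zX k) = glam k.
Proof. by move=> k0; rewrite [LHS]zeval_zX eqn0Ngt k0. Qed.

(** * Limits of series, and expansions of the basic elements *)

Lemma gcvg_unique u s s' : gcvg u s -> gcvg u s' -> s = s'.
Proof.
move=> us us'; apply: pseriesP => i; apply: laurentP => j.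
(* Convergence controls indices strictly below the bound, so j + 1 is what reaches the coefficient
   at j. *)
have [M0 e] := us i (j + 1); have [M1 e'] := us' i (j + 1).
by rewrite -(e (M0 + M1)%N) -1?(e' (M0 + M1)%N) //; lia.
Qed.

Lemma gcvg_shift u s n : gcvg u s -> gcvg (fun M => u (M + n)%N) s.
Proof.
move=> us i N; have [M0 e] := us i N; exists M0 => M MM0; apply: e.
exact: leq_trans MM0 (leq_addr _ _).
Qed.

Lemma gcvgD u s c : gcvg u s -> gcvg (fun M => u M + c) (s + c).
Proof.
move=> us i N; have [M0 e] := us i N; exists M0 => M MM0 j jN.
by rewrite /= e.
Qed.

Lemma gcvg_monM a b u s : gcvg u s ->
  gcvg (fun M => gt ^+ a * gLexp b * u M) (gt ^+ a * gLexp b * s).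
Proof.
(* The coefficient of the product at (i, j) is that of the factor at (i - a, j + b), so the
   precision is shifted by b. *)
move=> us i N; have [M0 e] := us (i - a)%N (N + b); exists M0 => M MM0 j jN.
by rewrite !lcoef_shift; case: leqP => // _; apply: e => //; lia.
Qed.

Lemma gcvg_near_eq M0 u v s : (forall M, (M0 <= M)%N -> u M = v M) ->
  gcvg u s -> gcvg v s.
Proof.
move=> uv us i N; have [M1 e] := us i N; exists (M0 + M1)%N => M MM j jN.
by rewrite -uv ?e //; lia.
Qed.

Lemma is_expansionX g F n : is_expansion g F -> is_expansion (g ^+ n) (F ^+ n).
Proof.
move=> gF; elim: n => [|n IH]; last by rewrite !exprS; apply: is_expansionM.
by have := is_expansion_zpoly 1; rewrite tofrac1 (rmorph1 gexpand).
Qed.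

Lemma is_expansion_t : is_expansion gt rt.
Proof. by have := is_expansion_zpoly (zX 0); rewrite gexpand_t. Qed.

Lemma is_expansion_lam k : (0 < k)%N -> is_expansion (glam k) (rX k).
Proof. by move=> k0; have := is_expansion_zpoly (zX k); rewrite gexpand_lam. Qed.

Lemma is_expansion_lamB1 k : (0 < k)%N -> is_expansion (glam k - 1) (rX k - 1).
Proof.
move=> /is_expansion_lam kE; apply: is_expansionD kE _.
by have := is_expansion_zpoly (-1); rewrite tofracN tofrac1 (rmorphN1 gexpand).
Qed.

Lemma gL_unit k : gL ^+ k * gLexp (- k%:Z) = 1.
Proof. by rewrite gLX -gLexpD addrN gLexp0. Qed.

Lemma is_expansion_divL g h F n : gL ^+ n * g = h -> is_expansion h F ->
  is_expansion g (F / rL ^+ n).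
Proof.
move=> gh hF; rewrite /rL /rX -tofracXn; apply: is_expansion_div hF.
  by apply: expf_neq0; rewrite -tofrac_eq0 rX_neq0.
by rewrite -gh (rmorph_expn _ _ gexpand _ _ n (gexpand_lam 1 isT)).
Qed.

(** Evaluation at L = 1 with all other variables 0 gives 1. For k = 1 the polynomial is L - L = 0:
    the diagonal relation does not determine G_{1,1}, which is prescribed instead. *)
Lemma lamX_neq0 k : (1 < k)%N -> zX 1 ^+ k - zX k * zX 0 ^+ (k * (k - 1)) != 0.
Proof.
move=> k1; pose v i : int := (i == 1%N)%:R.
have e := rmorph_binomial _ _ (zeval v) _ _ _ _ _ _ k (k * (k - 1))
  (zeval_zX v 1) (zeval_zX v k) (zeval_zX v 0).
apply/eqP => z0; move: e; rewrite z0 (rmorph0 (zeval v)) /v expr1n (gtn_eqF k1).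
by rewrite mul0r subr0.
Qed.

(** * Rationality of the family *)

Section Family.
Variables (G : nat -> nat -> gring) (hG : G_family G).

Let gq k : gring := gt ^+ (k * (k - 1)) * gLexp (- k%:Z).

Lemma G_diag k : (0 < k)%N ->
  G k k = gq k * (glam k * G k k + (glam k - 1) * \sum_(1 <= a < k) G k a).
Proof.
have [_ _ Gadd Gsum] := hG => k0; have [s us Gkk] := Gsum k k0.
suff sE : s = gq k * s + gq k * (\sum_(1 <= a < k) G k a + G k k).
  (* Multiplying by lambda_k - 1 turns the terms in s into G_{k,k}; together with the boundary term
     a = k they add up to lambda_k G_{k,k}. *)
  by rewrite [LHS]Gkk {1}sE !Gkk; ring.
apply: gcvg_unique (gcvg_shift _ _ k us) _.
(* The partial sum up to M + k is cut at 2k + 1, which is possible once M > k. Below the cut m = k +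
   a with 1 <= a <= k; above it the terms are q_k times the partial sum up to M. *)
apply: (@gcvg_near_eq k.+1 _ _ _ _ (gcvgD _ _ _ (gcvg_monM _ _ _ _ us))) => M kM.
rewrite -/(gq k) [RHS](@big_cat_nat _ _ _ (k.+1 + k)) ?leq_addr ?leq_add2r //= addrC.
rewrite -(big_nat_recr _ _ _ k0) !mulr_sumr; congr (_ + _).
  rewrite [RHS]big_addn addnK [LHS]big_nat [RHS]big_nat.
  by apply: eq_bigr => a /andP[a0 ak]; rewrite [RHS]Gadd ?addnK //; lia.
rewrite (big_addn 1 (k.+1 + k) k) addnK [LHS]big_nat [RHS]big_nat.
by apply: eq_bigr => a /andP[a0 ak]; rewrite [RHS]Gadd ?addnK //; lia.
Qed.


Lemma is_expansion_G11 : is_expansion (G 1 1) ((rL - 1) ^+ 2 / rL ^+ 2).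
Proof.
have [G11 _ _ _] := hG; apply: (@is_expansion_divL _ ((gL - 1) ^+ 2)).
  by rewrite G11 mulrCA [X in _ * X]gL_unit mulr1.
exact: is_expansionX (is_expansion_lamB1 1 isT).
Qed.

Lemma is_expansion_Gadd a b F : (0 < a)%N -> (0 < b)%N ->
  is_expansion (G a b) F ->
  is_expansion (G a (a + b)) (rt ^+ (a * (a - 1)) * F / rL ^+ a).
Proof.
have [_ _ Gadd _] := hG => a0 b0 GF.
apply: (@is_expansion_divL _ (gt ^+ (a * (a - 1)) * G a b)).
  rewrite Gadd ?addKn //; last by lia.
  by rewrite mulrA [gL ^+ a * _]mulrCA gL_unit mulr1.
by apply: is_expansionM GF; apply: is_expansionX is_expansion_t.
Qed.

(** Multiplying [G_diag] by L^k clears the negative power in q_k, so that G_{k,k} acquires the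
    polynomial coefficient L^k - lambda_k t^(k(k-1)). *)
Lemma is_expansion_Gdiag k F : (1 < k)%N ->
  is_expansion (\sum_(1 <= a < k) G k a) F ->
  is_expansion (G k k) ((rX k - 1) * rt ^+ (k * (k - 1)) * F
                        / (rL ^+ k - rX k * rt ^+ (k * (k - 1)))).
Proof.
move=> k1 SF; have k0 : (0 < k)%N by lia.
have -> : rL ^+ k - rX k * rt ^+ (k * (k - 1))
    = FracField.tofrac (zX 1 ^+ k - zX k * zX 0 ^+ (k * (k - 1))).
  by rewrite (rmorph_binomial _ _ (@FracField.tofrac _) _ _ _ rL (rX k) rt).
apply: is_expansion_div (lamX_neq0 k k1) _ _.
  rewrite (rmorph_binomial _ _ gexpand _ _ _ _ _ _ k (k * (k - 1))
    (gexpand_lam 1 isT) (gexpand_lam k k0) gexpand_t).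
  rewrite mulrBl.
  have -> : glam 1 ^+ k * G k k = gt ^+ (k * (k - 1))
      * (glam k * G k k + (glam k - 1) * \sum_(1 <= a < k) G k a).
    rewrite [G k k in LHS]G_diag // /gq !mulrA; congr (_ * _).
    by rewrite mulrAC -[glam 1]/gL gL_unit mul1r.
  rewrite mulrDr [X in _ + X - _]mulrA [_ * (glam k - 1)]mulrC.
  rewrite addrC mulrA [_ * glam k]mulrC addKr; reflexivity.
apply: is_expansionM SF; apply: is_expansionM (is_expansion_lamB1 k k0) _.
exact: is_expansionX is_expansion_t.
Qed.

Lemma is_expansion_G k m : (0 < k)%N -> (0 < m)%N ->
  exists F, is_expansion (G k m) F.
Proof.
have [_ Gsym _ _] := hG.
move: {2}(k + m)%N (leqnn (k + m)) => n.
elim: n k m => [|n IH] k m; first by case: k.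
wlog: k m / (k <= m)%N => [hw le_n k0 m0|].
  have [km|/ltnW mk] := leqP k m; first exact: hw.
  by rewrite Gsym //; apply: hw; rewrite // addnC.
rewrite leq_eqVlt => /orP [/eqP <-{m}|km] le_n k0 m0; last first.
  have [F GF] : exists F, is_expansion (G k (m - k)) F by apply: IH; lia.
  eexists; rewrite -(subnKC (ltnW km)); apply: is_expansion_Gadd GF => //; lia.
have [k1|k1] := leqP k 1.
  have -> : k = 1%N by lia.
  by eexists; apply: is_expansion_G11.
(* Since a < k, the pair (k, a) has a smaller index sum than (k, k). Outside 0 < a < k the chosen
   value 0 is arbitrary. *)
have /choice [F GF] : forall a, exists F, (0 < a < k)%N -> is_expansion (G k a) F.
  move=> a; have [/andP[a0 ak]|_] := boolP (0 < a < k)%N; last by exists 0.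
  by have [F GF] : exists F, is_expansion (G k a) F; [apply: IH; lia | exists F].
eexists; apply: is_expansion_Gdiag => //; apply: is_expansion_sum => a.
by rewrite mem_index_iota; apply: GF.
Qed.

End Family.

(** * Transfer of the abstract functional equation to the family *)

Lemma frac_cancel (K : fieldType) (S y t l x : K) : x != 0 ->
  x / l * (y * t * S / x) = y * (t / l) * S.
Proof. by move=> x0; rewrite mulrC -[LHS]mulrA mulKf // mulrAC !mulrA. Qed.

Theorem corollary2 (G : nat -> nat -> gring) (hG : G_family G)
    (k m : nat) (hk : (0 < k)%N) (hm : (0 < m)%N) :
  exists F : ratfun,
    unique (is_expansion (G k m)) F /\
    invert_vars F =
      rt ^- (2 * (k - 1) * (m - 1)) * rL ^+ (2 * k + 2 * m - 2) * F.
Proof.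
have /choice [R0 RE] : forall p : nat * nat, exists F,
    (0 < p.1)%N && (0 < p.2)%N -> is_expansion (G p.1 p.2) F.
  move=> p.
  have [/andP[p1 p2]|_] := boolP ((0 < p.1)%N && (0 < p.2)%N); last by exists 0.
  by have [F GF] := is_expansion_G G hG _ _ p1 p2; exists F.
pose R a b := R0 (a, b).
have {RE}RE a b : (0 < a)%N -> (0 < b)%N -> is_expansion (G a b) (R a b).
  by move=> a0 b0; apply: (RE (a, b)); rewrite a0 b0.
(* Uniqueness transfers relations from G to R: it suffices to show that the wanted expression is an
   expansion of the same [G a b]. *)
have eR a b F : (0 < a)%N -> (0 < b)%N -> is_expansion (G a b) F -> R a b = F.
  by move=> a0 b0; apply: is_expansion_unique; apply: RE.
exists (R k m); split; first by split=> [|F]; [exact: RE | exact: eR].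
(* Positivity of a makes the natural number a - 1 agree with the integer one. *)
have qE a : (0 < a)%N -> rt ^ (a%:Z * (a%:Z - 1)) * rL ^ (- a%:Z)
    = rt ^+ (a * (a - 1)) / rL ^+ a.
  move=> a0; congr (_ * _); last by rewrite -exprnN.
  by rewrite exprnP; congr (_ ^ _); case: a a0 => // a _; rewrite subn1 /=; lia.
have rL0 : rL != 0 by exact: rX_neq0.
have lamE a : (0 < a)%N -> 1 - rX a * (rt ^ (a%:Z * (a%:Z - 1)) * rL ^ (- a%:Z))
    = (rL ^+ a - rX a * rt ^+ (a * (a - 1))) / rL ^+ a.
  by move=> a0; rewrite qE // mulrBl divff ?expf_neq0 // mulrA.
have lam0 a : (1 < a)%N -> rL ^+ a - rX a * rt ^+ (a * (a - 1)) != 0.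
  move=> /lamX_neq0; rewrite -tofrac_eq0.
  by rewrite (rmorph_binomial _ _ (@FracField.tofrac _) _ _ _ rL (rX a) rt).
apply: etrans
  (reciprocity _ invert_vars rt rL rX R _ _ _ _ _ _ _ _ _ _ _ k m hk hm) _.
- exact: rX_neq0.
- exact: rL0.
- by move=> a _; apply: rX_neq0.
- exact: invert_vars_rX.
- exact: invert_vars_rX.
- by move=> a _; apply: invert_vars_rX.
- by apply: eR => //; apply: is_expansion_G11.
- move=> a b a0 b0; apply: eR => //.
  by have [_ Gsym _ _] := hG; rewrite Gsym //; apply: RE.
- move=> a b a0 b0; rewrite qE // mulrAC; apply: eR => //; first by lia.
  by apply: is_expansion_Gadd => //; apply: RE.
- move=> a a1; rewrite (lamE a (ltnW a1)); apply: mulf_neq0; first exact: lam0.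
  by rewrite invr_eq0 expf_neq0.
- move=> a a1; have a0 : (0 < a)%N by lia.
  have Raa : R a a = (rX a - 1) * rt ^+ (a * (a - 1)) * (\sum_(1 <= b < a) R a b)
      / (rL ^+ a - rX a * rt ^+ (a * (a - 1))).
    apply: eR => //; apply: is_expansion_Gdiag => //.
    apply: is_expansion_sum => b; rewrite mem_index_iota => /andP[b0 _].
    exact: RE.
  (* The coefficient 1 - lambda_a q_a is the denominator of [R a a] divided by L^a, so this
     denominator cancels. *)
  apply: etrans (congr2 *%R (lamE a a0) Raa) _.
  apply: etrans (frac_cancel _ _ _ _ _ _ (lam0 a a1)) _.
  exact: (congr1 (fun x => (rX a - 1) * x * _) (esym (qE a a0))).
(* Natural and integer exponents agree because k and m are at least 1. *)
- rewrite exprnN exprnP; congr (_ ^ _ * _ ^ _ * _); last by lia.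
  by case: k m hk hm => [|k'] [|m'] // _ _; rewrite !subn1 /=; lia.
Qed.
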